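(* Assume $\beta>0$ and $\zeta_l+\zeta_r>0$. Then every eigenvalue of the linear map $l$ on $M_N(\mathbb{C})$ has strictly negative real part. In particular $l$ is invertible and $\lim_{t\to\infty}e^{tl}=0$.
   Context: Fix an integer $N\ge 2$ and a bounded function $v:\mathbb{N}=\{1,2,\dots\}\to\mathbb{R}$. Let $e_1,\dots,e_N$ be the standard basis of $\mathbb{C}^N$ and $p_n=|e_n\rangle\langle e_n|$. Let $h$ be the Hermitian $N\times N$ matrix $(h\psi)(n)=-\psi(n+1)-\psi(n-1)+v(n)\psi(n)$, $n=1,\dots,N$, with the convention $\psi(0)=\psi(N+1)=0$. Let $\alpha_{in}^l,\alpha_{out}^l,\alpha_{in}^r,\alpha_{out}^r,\beta\ge 0$ be real numbers and put $\zeta_l=\alpha_{in}^l+\alpha_{out}^l$, $\zeta_r=\alpha_{in}^r+\alpha_{out}^r$. Define the linear map $l:M_N(\mathbb{C})\to M_N(\mathbb{C})$ by $l(a)=-i[h,a]-\{\zeta_l p_1+\zeta_r p_N,a\}+\beta\left(\sum_{n=1}^N p_nap_n-a\right)$, where $[x,y]=xy-yx$ and $\{x,y\}=xy+yx$. *)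

(* Defs.v *)
From HB Require Import structures.
From mathcomp Require Import all_boot all_order all_algebra.
From mathcomp Require Import all_classical all_reals all_analysis.
From mathcomp Require Import complex.
Set Implicit Arguments. Unset Strict Implicit. Unset Printing Implicit Defensive.
Import Order.TTheory GRing.Theory Num.Theory.
Import numFieldNormedType.Exports.
Local Open Scope ring_scope.
Local Open Scope complex_scope.

(* Equip C = R[i] with its usual (modulus) metric topology, as for any
   numFieldType, so that 'M[R[i]]_N gets its standard normed topology. *)
HB.instance Definition _ (R : realType) := PseudoPointedMetric.copy R[i] R[i]^o.

Section Lindblad.
Variables (R : realType) (N : nat).
Local Notation C := R[i].

(* p_n = |e_n><e_n|, with the paper's 1-based index n (row/col i : 'I_N
   corresponds to the basis vector e_{i+1}). *)
Definition projn (n : nat) : 'M[C]_N :=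
  \matrix_(i, j) (((i.+1 == n) && (j.+1 == n))%:R).

(* (h psi)(n) = - psi(n+1) - psi(n-1) + v(n) psi(n), psi(0) = psi(N+1) = 0;
   row i / column j of the matrix correspond to n = i+1, m = j+1. *)
Definition hmat (v : nat -> R) : 'M[C]_N :=
  \matrix_(i, j) ((v i.+1)%:C * (i == j :> nat)%:R
                  - (j == i.+1 :> nat)%:R - (i == j.+1 :> nat)%:R).

Definition commr (x y : 'M[C]_N) := x *m y - y *m x.
Definition anticommr (x y : 'M[C]_N) := x *m y + y *m x.

Definition lmap (v : nat -> R) (zl zr beta : R) (a : 'M[C]_N) : 'M[C]_N :=
  - ('i *: commr (hmat v) a)
  - anticommr (zl%:C *: projn 1 + zr%:C *: projn N) a
  + beta%:C *: ((\sum_(1 <= n < N.+1) projn n *m a *m projn n) - a).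

Definition expmap (L : 'M[C]_N -> 'M[C]_N) (t : R) (a : 'M[C]_N) : 'M[C]_N :=
  limn (series (fun k => (t ^+ k / (k`!)%:R)%:C *: iter k L a)).

End Lindblad.

(* Main.v *)
(** Pairing [l a] with [a] in the Hilbert-Schmidt inner product kills the
    commutator (as [h] is Hermitian) and leaves
    [Re <a, l a> = - sum_ij (d_i + d_j + beta [i != j]) |a_ij|^2], where [d] is
    the diagonal of [zeta_l p_1 + zeta_r p_N].  If [l a = lam a] with
    [Re lam >= 0], then every term vanishes: [a] is diagonal because
    [beta > 0], the entries [(i, i+1)] of the eigenvalue equation make the
    diagonal constant, and [zeta_l + zeta_r > 0] kills one of its ends.

    For the decay, Cayley-Hamilton gives eigenvalues [z_1, ..., z_m] of [l]
    with [(l - z_1) ... (l - z_m) = 0], and one inducts on [m]: if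
    [w(t) = e^{tl} (l - z) a] tends to [0] and [Re z < 0], then
    [u(t) = e^{tl} a] solves [u' = z u + w], hence tends to [0]. *)
Require Import Defs.
From HB Require Import structures.
From mathcomp Require Import all_boot all_order all_algebra.
From mathcomp Require Import all_classical all_reals all_analysis.
From mathcomp Require Import complex.
From mathcomp Require Import ring lra.
Set Implicit Arguments. Unset Strict Implicit. Unset Printing Implicit Defensive.
Import Order.TTheory GRing.Theory Num.Theory.
Import numFieldNormedType.Exports.
Local Open Scope ring_scope.
Local Open Scope complex_scope.
Local Open Scope classical_set_scope.

(** * Convergence of complex matrices through real and imaginary parts *)

Lemma normc_le_ReIm (R : rcfType) (z : R[i]) :
  `|z| <= (`|complex.Re z| + `|complex.Im z|)%:C.
Proof.
case: z => x y; rewrite normc_def lecR /=.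
have -> : `|x| + `|y| = Num.sqrt ((`|x| + `|y|) ^+ 2).
  by rewrite sqrtr_sqr [RHS]ger0_norm ?addr_ge0//.
rewrite ler_wsqrtr//.
by rewrite sqrrD !real_normK ?num_real// lerD2r lerDl mulrn_wge0.
Qed.

Lemma cvg_mx_ReIm (R : realType) (T : Type) (F : set_system T) {FF : Filter F}
    m n (f : T -> 'M[R[i]]_(m, n)) (M : 'M[R[i]]_(m, n)) :
  (forall i j, complex.Re (f x i j) @[x --> F] --> complex.Re (M i j)) ->
  (forall i j, complex.Im (f x i j) @[x --> F] --> complex.Im (M i j)) ->
  f x @[x --> F] --> M.
Proof.
move=> fRe fIm; apply/cvgrPdist_lt => e e0.
(* The radius [e] lives in [R[i]]; being positive in its partial order forces it to be real. *)
have [eRe eE] : 0 < complex.Re e /\ e = (complex.Re e)%:C.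
  by case: e e0 => x y; rewrite ltcE/= => /andP[/eqP-> ?].
have e2 : 0 < complex.Re e / 2 by rewrite divr_gt0.
have near_ij : \forall x \near F, forall ij : 'I_m * 'I_n,
    `|M ij.1 ij.2 - f x ij.1 ij.2| < e.
  apply: filter_forall => -[i j] /=.
  move/cvgrPdist_lt : (fRe i j) => /(_ _ e2).
  move/cvgrPdist_lt : (fIm i j) => /(_ _ e2).
  apply: filterS2 => x hIm hRe; rewrite eE (le_lt_trans (normc_le_ReIm _))// ltcR.
  by rewrite [ltRHS]splitr !raddfB ltrD.
apply: filterS near_ij => x hx.
have := @mx_norm_ball R[i] m n; move=> /(congr1 (fun b => b M e (f x))) /= <-.
by split=> // i j; exact: (hx (i, j)).
Qed.

(** Integrating factor: once [g <= - x * (e / 2)], the hypothesis gives [f' <= x * (f - e / 2)], so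
    [expR (- x * t) * (f t - e / 2)] is nonincreasing. Hence [f - e / 2] is bounded by a multiple of
    [expR (x * t)], which tends to 0. *)
Lemma decay_differential_ineq (R : realType) (f f' g : R -> R) (x : R) :
  x < 0 -> (forall t, 0 <= f t) -> (forall t : R, is_derive t 1 f (f' t)) ->
  (forall t, f' t <= x * f t + g t) ->
  g t @[t --> +oo] --> 0 -> f t @[t --> +oo] --> 0.
Proof.
move=> x0 f0 df f'le g0; apply/cvgrPdist_le => e e0.
have d0 : 0 < - x * (e / 2) by rewrite mulr_gt0 ?divr_gt0 ?oppr_gt0.
move/cvgrPdist_le : g0 => /(_ _ d0) [T [_ gT]].
(* The filter bounds [g] only for [t > T]; the shift gives a closed half-line. *)
pose T1 := T + 1.
have gT1 t : T1 <= t -> g t <= - x * (e / 2).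
  move=> tT; have /= := gT t; rewrite sub0r normrN => /(_ _)/ler_normlW; apply.
  by rewrite (lt_le_trans _ tT)// ltrDl.
pose h (t : R) := expR (- x * t) * (f t - e / 2).
pose h' (t : R) := expR (- x * t) * (f' t - x * (f t - e / 2)).
have dh (t : R) : is_derive t 1 h (h' t).
  have dft := df t.
  apply: is_derive_eq; rewrite /h' /GRing.scale /=; ring.
have hle t : T1 <= t -> h t <= h T1.
  move=> tT; apply: (@ler0_derive1_nincry R h T1 _ _ _ _ _ _ tT).
  - by move=> s _; have [] := dh s.
  - move=> s; rewrite in_itv/= andbT => sT.
    rewrite derive1E (@derive_val _ _ _ _ _ _ _ (dh s)).
    rewrite /h' mulr_ge0_le0 ?expR_ge0//.
    have := f'le s; have := gT1 s (ltW sT); nra.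
  - by apply: derivable_within_continuous => s _; have [] := dh s.
  - exact: lexx.
near=> t.
have Et : `|h T1| <= expR (- x * t) * (e / 2).
  have H0 : 0 < - x * e by rewrite mulr_gt0 ?oppr_gt0.
  (* This threshold makes [- x * t * (e / 2)] at least [|h T1|], and [1 + s <= expR s] does the
     rest. *)
  have : 2 * `|h T1| / (- x * e) <= t by near: t; apply: nbhs_pinfty_ge; exact: num_real.
  rewrite ler_pdivrMr// => ht; have := expR_ge1Dx (- x * t).
  nra.
have := hle t; have -> : T1 <= t by near: t; apply: nbhs_pinfty_ge; exact: num_real.
move=> /(_ isT) /le_trans/(_ (le_trans (ler_norm _) Et)).
rewrite /h ler_pM2l ?expR_gt0// sub0r normrN ger0_norm// => ?.
lra.
Unshelve. all: by end_near. Qed.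

(** * Boundedness of linear maps on matrices *)

Lemma mx_entry_le_norm (K : numDomainType) m n (a : 'M[K]_(m, n)) i j :
  `|a i j| <= `|a|.
Proof.
rewrite {2}/Num.Def.normr /= mx_normE -[leLHS]nngE num_le.
exact: (le_bigmax _ _ (i, j)).
Qed.

(** Expand [a] in matrix units: its coefficients are at most [|a|], so the sum of the norms of the
    images of the units serves as [K]. *)
Lemma linear_mx_bounded (R : realType) m n
    (L : {linear 'M[R[i]]_(m, n) -> 'M[R[i]]_(m, n)}) :
  exists2 K : R, 0 <= K & forall a, `|L a| <= K%:C * `|a|.
Proof.
pose S : R[i] := \sum_i \sum_j `|L (delta_mx i j)|.
have S0 : 0 <= S by do 2!(apply: sumr_ge0 => ? _).
have SK : S = (complex.Re S)%:C.
  by apply/eqP; rewrite eq_complex /= (ger0_Im S0) !eqxx.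
have K0 : 0 <= complex.Re S by rewrite -lecR -SK.
exists (complex.Re S) => // a; rewrite -SK {1}(matrix_sum_delta a) linear_sum.
rewrite mulr_suml (le_trans (ler_norm_sum _ _ _))//; apply: ler_sum => i _.
rewrite linear_sum mulr_suml (le_trans (ler_norm_sum _ _ _))//.
apply: ler_sum => j _; rewrite linearZ /= normrZ mulrC ler_wpM2l//.
exact: mx_entry_le_norm.
Qed.

(** * Exponential generating functions of geometrically bounded sequences *)

Lemma is_cvg_pseries_exp_bounded (R : realType) (u : R^nat) (C K x : R) :
  (forall k, `|u k| <= C * K ^+ k) ->
  cvgn (pseries (fun k => u k / k`!%:R) x).
Proof.
move=> uCK; apply: normed_cvg.
apply: (@series_le_cvg _ _ (fun k => C * exp_coeff (K * `|x|) k)) => [k|k|k|].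
- exact: normr_ge0.
- rewrite /exp_coeff /= exprMn; have := le_trans (normr_ge0 _) (uCK k).
  by move=> ?; rewrite !mulrA divr_ge0// mulr_ge0// exprn_ge0.
- rewrite /exp_coeff /= !normrM normfV normrX exprMn.
  rewrite [X in `|u k| * X^-1]ger0_norm// mulrAC !mulrA ler_wpM2r ?invr_ge0//.
  by rewrite ler_wpM2r ?exprn_ge0.
- apply: is_cvg_seriesZ; exact: is_cvg_series_exp_coeff.
Qed.

(** Differentiating an exponential generating function term by term shifts its coefficients; this is
    how [L] will appear as the time derivative. *)
Lemma pseries_diffs_exp (R : realType) (u : R^nat) :
  pseries_diffs (fun k => u k / k`!%:R) = (fun k => u k.+1 / k`!%:R).
Proof.
apply/funext => k; rewrite /pseries_diffs factS natrM invfM.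
by rewrite mulrCA [k.+1%:R * _]mulrA divff ?pnatr_eq0// mul1r.
Qed.

(** The exponential generating function of [u]. With [u] the real or imaginary part of an entry of
    [iter k L a], it is that part of the entry of [e^{tL} a]. *)
Definition expseries (R : realType) (u : R^nat) (t : R) : R :=
  limn (pseries (fun k => u k / k`!%:R) t).

Lemma is_derive_expseries (R : realType) (u : R^nat) (C K x : R) :
  (forall k, `|u k| <= C * K ^+ k) ->
  is_derive x 1 (expseries u) (expseries (fun k => u k.+1) x).
Proof.
move=> uCK; rewrite /expseries -pseries_diffs_exp.
have uCK1 k : `|u k.+1| <= C * K * K ^+ k by rewrite -mulrA -exprS.
have uCK2 k : `|u k.+2| <= C * K * K * K ^+ k by rewrite -mulrA -exprS.
(* Termwise differentiation at [x] asks that the series and its first two formal derivatives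
   converge at a point of larger modulus, here [|x| + 1]. *)
apply: (@pseries_snd_diffs _ _ (`|x| + 1)); rewrite ?pseries_diffs_exp.
- exact: is_cvg_pseries_exp_bounded uCK.
- exact: is_cvg_pseries_exp_bounded uCK1.
- exact: is_cvg_pseries_exp_bounded uCK2.
- by rewrite [ltRHS]ger0_norm ?addr_ge0// ltrDl.
Qed.

(** The three-term shape is that of the real and imaginary parts of [lam * u + w]. A common rate [K]
    suffices since all sequences come from iterates of one map. *)
Lemma expseries_lin (R : realType) (p q : R) (u v w : R^nat) (C D E K t : R) :
  (forall k, `|u k| <= C * K ^+ k) -> (forall k, `|v k| <= D * K ^+ k) ->
  (forall k, `|w k| <= E * K ^+ k) ->
  expseries (fun k => p * u k + q * v k + w k) t =
  p * expseries u t + q * expseries v t + expseries w t.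
Proof.
move=> uC vD wE.
have cu := is_cvg_pseries_exp_bounded (x := t) uC.
have cv := is_cvg_pseries_exp_bounded (x := t) vD.
have cw := is_cvg_pseries_exp_bounded (x := t) wE.
apply: cvg_lim => //.
have -> : pseries (fun k => (p * u k + q * v k + w k) / k`!%:R) t =
    (fun n => p * pseries (fun k => u k / k`!%:R) t n
      + q * pseries (fun k => v k / k`!%:R) t n
      + pseries (fun k => w k / k`!%:R) t n).
  apply/funext => n; rewrite /pseries /series /= !mulr_sumr -!big_split /=.
  by apply: eq_bigr => k _; ring.
by apply: cvgD => //; apply: cvgD; apply: cvgMl_tmp.
Qed.

Lemma Re_real_mul (R : rcfType) (x : R) (z : R[i]) :
  complex.Re (x%:C * z) = x * complex.Re z.
Proof. by case: z => a b /=; rewrite mul0r subr0. Qed.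

Lemma Im_real_mul (R : rcfType) (x : R) (z : R[i]) :
  complex.Im (x%:C * z) = x * complex.Im z.
Proof. by case: z => a b /=; rewrite mul0r addr0. Qed.

Lemma normc_ge_Im (R : rcfType) (z : R[i]) : `|complex.Im z|%:C <= `|z|.
Proof.
by case: z => x y; rewrite normc_def lecR /= -sqrtr_sqr ler_wsqrtr// lerDr sqr_ge0.
Qed.

(** * The flow [e^{tL}] of a linear map *)

Section LinearFlow.
Variables (R : realType) (N : nat) (L : {linear 'M[R[i]]_N -> 'M[R[i]]_N}).

Lemma iter_linear_bounded : exists K : R,
  forall a i j, exists C : R, forall k,
    `|complex.Re (iter k L a i j)| <= C * K ^+ k /\
    `|complex.Im (iter k L a i j)| <= C * K ^+ k.
Proof.
have [K K0 LK] := linear_mx_bounded L; exists K => // a i j.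
have normE : `|a| = (complex.Re `|a|)%:C.
  by apply/eqP; rewrite eq_complex /= (ger0_Im (normr_ge0 a)) !eqxx.
exists (complex.Re `|a|) => k.
have iterK : `|iter k L a| <= (complex.Re `|a| * K ^+ k)%:C.
  elim: k => [|k IH]; first by rewrite expr0 mulr1 -normE.
  rewrite iterS (le_trans (LK _))// exprS mulrCA [leRHS]rmorphM /=.
  by rewrite ler_wpM2l// lecR.
split; rewrite -lecR; apply: le_trans iterK;
  by apply: le_trans (mx_entry_le_norm _ i j); rewrite ?normc_ge_Re ?normc_ge_Im.
Qed.

(** The geometric bound makes every entry converge, so the [limn] in [expmap] is a true limit and
    not a default value. Splitting into real and imaginary parts opens the way to real calculus. *)
Lemma expmap_entries t a : expmap L t a =
  \matrix_(i, j) (expseries (fun k => complex.Re (iter k L a i j)) t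
               +i* expseries (fun k => complex.Im (iter k L a i j)) t).
Proof.
have [K LK] := iter_linear_bounded.
apply: (@cvg_lim _ (@norm_hausdorff R[i] ('M[R[i]]_N : normedModType _))).
apply: cvg_mx_ReIm => i j; have [C LC] := LK a i j; rewrite mxE /=.
- rewrite (_ : (fun n => _) =
    pseries (fun k => complex.Re (iter k L a i j) / k`!%:R) t).
    by apply: (@is_cvg_pseries_exp_bounded _ _ C K) => k; have [] := LC k.
  apply/funext => n; rewrite /pseries /series /= summxE raddf_sum.
  by apply: eq_bigr => k _ /=; rewrite mxE Re_real_mul mulrC mulrA mulrAC.
- rewrite (_ : (fun n => _) =
    pseries (fun k => complex.Im (iter k L a i j) / k`!%:R) t).
    by apply: (@is_cvg_pseries_exp_bounded _ _ C K) => k; have [] := LC k.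
  apply/funext => n; rewrite /pseries /series /= summxE raddf_sum.
  by apply: eq_bigr => k _ /=; rewrite mxE Im_real_mul mulrC mulrA mulrAC.
Qed.

Lemma iter_linearP k c a b : iter k L (c *: a + b) = c *: iter k L a + iter k L b.
Proof. by elim: k => [//|k IH]; rewrite !iterS IH linearP. Qed.

Lemma cvg_mx0_ReIm (T : Type) (F : set_system T) {FF : Filter F}
    (f : T -> 'M[R[i]]_N) (i j : 'I_N) :
  f x @[x --> F] --> (0 : 'M[R[i]]_N) ->
  complex.Re (f x i j) @[x --> F] --> (0 : R) /\
  complex.Im (f x i j) @[x --> F] --> (0 : R).
Proof.
move=> /cvgr0Pnorm_le f0.
have near_le (e : R) : 0 < e -> \forall x \near F, `|f x i j| <= e%:C.
  rewrite -ltcR => /f0; apply: filterS => x; apply: le_trans.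
  exact: mx_entry_le_norm.
split; apply/cvgr0Pnorm_le => e /near_le; apply: filterS => x fx; rewrite -lecR;
  by apply: le_trans fx; rewrite ?normc_ge_Re ?normc_ge_Im.
Qed.

(** Each entry [u] of the flow satisfies [u' = lam u + w]. Passing to [f = |u|^2] removes the
    rotation due to the imaginary part of [lam] and leaves a scalar inequality [f' <= x f + g],
    where [x] is the real part of [lam] and [g = - x^-1 |w|^2] tends to 0. *)
Lemma expmap_decay_step lam a : complex.Re lam < 0 ->
  expmap L t (L a - lam *: a) @[t --> +oo] --> (0 : 'M[R[i]]_N) ->
  expmap L t a @[t --> +oo] --> (0 : 'M[R[i]]_N).
Proof.
set b := L a - _; case: lam @b => x y b /= x0 b0.
have [K LK] := iter_linear_bounded.
have u2_0 i j :
  (expseries (fun k => complex.Re (iter k L a i j)) t) ^+ 2 +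
  (expseries (fun k => complex.Im (iter k L a i j)) t) ^+ 2 @[t --> +oo] --> (0 : R).
  have [w10 w20] := cvg_mx0_ReIm i j b0.
  set u1k := fun k => complex.Re (iter k L a i j).
  set u2k := fun k => complex.Im (iter k L a i j).
  pose w1k k := complex.Re (iter k L b i j).
  pose w2k k := complex.Im (iter k L b i j).
  have [C LC] := LK a i j; have [D LD] := LK b i j.
  have u1C k : `|u1k k| <= C * K ^+ k by have [] := LC k.
  have u2C k : `|u2k k| <= C * K ^+ k by have [] := LC k.
  have w1D k : `|w1k k| <= D * K ^+ k by have [] := LD k.
  have w2D k : `|w2k k| <= D * K ^+ k by have [] := LD k.
  (* Since [L a = lam a + b], this recursion on coefficients is the differential equation
     [u' = lam u + w] for the generating functions. *)
  have iterLa k : iter k.+1 L a i j = (x +i* y) * iter k L a i j + iter k L b i j.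
    rewrite iterSr; have -> : L a = (x +i* y) *: a + b by rewrite addrC subrK.
    by rewrite iter_linearP !mxE.
  have u1S : (fun k => u1k k.+1) = (fun k => x * u1k k + (- y) * u2k k + w1k k).
    apply/funext => k; rewrite /u1k iterLa /w1k /u2k.
    by case: (iter k L a i j) (iter k L b i j) => ? ? [? ?] /=; rewrite mulNr.
  have u2S : (fun k => u2k k.+1) = (fun k => y * u1k k + x * u2k k + w2k k).
    apply/funext => k; rewrite /u2k iterLa /w2k /u1k.
    by case: (iter k L a i j) (iter k L b i j) => ? ? [? ?] /=; ring.
  pose u1 := expseries u1k; pose u2 := expseries u2k.
  pose w1 := expseries w1k; pose w2 := expseries w2k.
  have du1 (t : R) : is_derive t 1 u1 (x * u1 t - y * u2 t + w1 t).
    have := is_derive_expseries t u1C; rewrite u1S.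
    by rewrite (expseries_lin _ _ _ u1C u2C w1D) mulNr.
  have du2 (t : R) : is_derive t 1 u2 (y * u1 t + x * u2 t + w2 t).
    have := is_derive_expseries t u2C; rewrite u2S.
    by rewrite (expseries_lin _ _ _ u1C u2C w2D).
  pose f (t : R) := u1 t ^+ 2 + u2 t ^+ 2.
  pose f' (t : R) := 2 * (u1 t * (x * u1 t - y * u2 t + w1 t))
                   + 2 * (u2 t * (y * u1 t + x * u2 t + w2 t)).
  have df (t : R) : is_derive t 1 f (f' t).
    have d1 := du1 t; have d2 := du2 t.
    apply: is_derive_eq; rewrite /f' /GRing.scale /=; ring.
  have w1E t : complex.Re (expmap L t b i j) = w1 t by rewrite expmap_entries mxE.
  have w2E t : complex.Im (expmap L t b i j) = w2 t by rewrite expmap_entries mxE.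
  (* Completing squares: [x f + g - f' = - x^-1 |x u + w|^2]. *)
  apply: (@decay_differential_ineq R f f'
    (fun t => - x^-1 * (w1 t ^+ 2 + w2 t ^+ 2)) x x0 _ df).
  - by move=> t; rewrite addr_ge0 ?sqr_ge0.
  - move=> t; rewrite -subr_ge0.
    have -> : x * f t + - x^-1 * (w1 t ^+ 2 + w2 t ^+ 2) - f' t =
        - x^-1 * ((x * u1 t + w1 t) ^+ 2 + (x * u2 t + w2 t) ^+ 2).
      by rewrite /f /f'; field; rewrite lt_eqF.
    by rewrite mulr_ge0 ?oppr_ge0 ?invr_le0 ?(ltW x0)// addr_ge0 ?sqr_ge0.
  - rewrite -[X in _ --> X](mulr0 (- x^-1)); apply: cvgMl_tmp.
    rewrite -[X in _ --> X]addr0; apply: cvgD; rewrite -[X in _ --> X](mulr0 0).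
      apply: cvgM; rewrite -(funext w1E); exact: w10.
    apply: cvgM; rewrite -(funext w2E); exact: w20.
have u_0 (g h : R -> R) : g t ^+ 2 + h t ^+ 2 @[t --> +oo] --> (0 : R) ->
    g t @[t --> +oo] --> (0 : R).
  move=> /cvgr0Pnorm_le gh0; apply/cvgr0Pnorm_le => e e0.
  have : 0 < e ^+ 2 by rewrite exprn_gt0.
  move=> /gh0; apply: filterS => t; rewrite ger0_norm ?addr_ge0 ?sqr_ge0// => ght.
  rewrite -ler_sqr ?nnegrE ?(ltW e0)// real_normK ?num_real//.
  by apply: le_trans ght; rewrite lerDl sqr_ge0.
apply: cvg_mx_ReIm => i j; rewrite mxE /=.
- rewrite (_ : (fun t => _) =
    expseries (fun k => complex.Re (iter k L a i j))); last first.
    by apply/funext => t; rewrite expmap_entries mxE.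
  exact: u_0 (u2_0 i j).
- rewrite (_ : (fun t => _) =
    expseries (fun k => complex.Im (iter k L a i j))); last first.
    by apply/funext => t; rewrite expmap_entries mxE.
  have := u2_0 i j; under eq_fun do rewrite addrC; exact: u_0.
Qed.

End LinearFlow.

(** * From the location of the spectrum to decay and invertibility *)

(** Split the characteristic polynomial into linear factors and apply Cayley-Hamilton; in size 0 the
    empty product is already zero. *)
Lemma eigenvalues_annihilate (F : closedFieldType) n (A : 'M[F]_n) :
  exists2 s : seq F, {in s, forall z, eigenvalue A z} &
    \big[mulmx/1%:M]_(z <- s) (A - z%:M) = 0.
Proof.
case: n A => [|n] A; first by exists [::]; rewrite // big_nil flatmx0.
have [s] := closed_field_poly_normal (char_poly A).
rewrite (monicP (char_poly_monic A)) scale1r => sE; exists s.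
  by move=> z zs; rewrite eigenvalue_root_char sE root_prod_XsubC.
rewrite -[RHS](Cayley_Hamilton A) sE rmorph_prod /=.
by apply: eq_bigr => z _; rewrite rmorphB /= horner_mx_X horner_mx_C.
Qed.

Lemma expmap_decay (R : realType) (N : nat)
    (L : {linear 'M[R[i]]_N -> 'M[R[i]]_N}) :
  (forall lam a, a != 0 -> L a = lam *: a -> complex.Re lam < 0) ->
  forall a, expmap L t a @[t --> +oo] --> (0 : 'M[R[i]]_N).
Proof.
move=> Llt0 a.
have [s s_eig s0] := eigenvalues_annihilate (lin_mx L).
have {s_eig} s_lt0 : {in s, forall z, complex.Re z < 0}.
  move=> z /s_eig /eigenvalueP[v]; rewrite mul_rV_lin => /(congr1 vec_mx).
  rewrite mxvecK linearZ /= => Lv v0; apply: Llt0 Lv.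
  by apply: contraNneq v0 => v0; rewrite -[v]vec_mxK v0 linear0.
(* The induction needs the product to kill the vector of [a] only, since a tail of the product need
   not vanish as a matrix. Row vectors meet the first factor first, so peeling it off replaces [a]
   by [L a - z *: a]. *)
have : mxvec a *m \big[mulmx/1%:M]_(z <- s) (lin_mx L - z%:M) = 0.
  by rewrite s0 mulmx0.
elim: s {s0} s_lt0 a => [_|z s IH s_lt0] a.
  rewrite big_nil mulmx1 => /(congr1 vec_mx); rewrite mxvecK linear0 => ->.
  rewrite (_ : (fun t => _) = fun=> 0); first exact: cvg_cst.
  apply/funext => t; rewrite /expmap (_ : series _ = fun=> 0) ?lim_cst//.
  apply/funext => n; rewrite /series /= big1// => k _.
  suff -> : iter k L 0 = 0 by rewrite scaler0.
  by elim: k => //= k ->; rewrite linear0.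
rewrite big_cons mulmxA mulmxBr mul_vec_lin mul_mx_scalar -linearZ -linearB => as0.
apply: (@expmap_decay_step _ _ _ z).
  by apply: s_lt0; rewrite mem_head.
by apply: IH => // y ys; apply: s_lt0; rewrite inE ys orbT.
Qed.

Lemma linear_mx_bijective (F : fieldType) m n
    (L : {linear 'M[F]_(m, n) -> 'M[F]_(m, n)}) :
  (forall a, L a = 0 -> a = 0) -> bijective L.
Proof.
move=> L0; have Lunit : lin_mx L \in unitmx.
  rewrite -row_free_unit -kermx_eq0; apply/eqP/row_matrixP => i; rewrite row0.
  have : row i (kermx (lin_mx L)) *m lin_mx L = 0 by rewrite -row_mul mulmx_ker row0.
  rewrite mul_rV_lin => /(congr1 vec_mx); rewrite mxvecK linear0 => /L0.
  by move=> /(congr1 mxvec); rewrite vec_mxK linear0.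
exists (fun b => vec_mx (mxvec b *m invmx (lin_mx L))) => a.
  by rewrite -mul_vec_lin mulmxK// mxvecK.
by apply: (can_inj mxvecK); rewrite -mul_vec_lin vec_mxK mulmxKV.
Qed.

(** * The spectrum of [l] *)

Section Spectrum.
Variables (R : realType) (N : nat) (v : nat -> R) (zl zr beta : R).
Local Notation C := R[i].
Local Notation l := (@lmap R N v zl zr beta).

Lemma lmap_linear : linear l.
Proof.
move=> c a b; rewrite /lmap /commr /anticommr.
move: (hmat N v) (zl%:C *: _ + _) => h D.
have -> : \sum_(1 <= n < N.+1) projn R N n *m (c *: a + b) *m projn R N n =
   c *: (\sum_(1 <= n < N.+1) projn R N n *m a *m projn R N n)
   + \sum_(1 <= n < N.+1) projn R N n *m b *m projn R N n.
  rewrite scaler_sumr -big_split; apply: eq_bigr => n _.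
  by rewrite mulmxDr mulmxDl -scalemxAr -scalemxAl.
rewrite !mulmxDr !mulmxDl -!scalemxAr -!scalemxAl.
move: (h *m a) (h *m b) (a *m h) (b *m h) (D *m a) (D *m b) (a *m D) (b *m D).
move: (\sum_(_ <= _ < _) _) (\sum_(_ <= _ < _) _) => *.
by apply/matrixP => i j; rewrite !mxE; ring.
Qed.

HB.instance Definition _ := GRing.isLinear.Build C 'M[C]_N 'M[C]_N _ l lmap_linear.

(** The diagonal of [zeta_l p_1 + zeta_r p_N]. *)
Definition loss (i : 'I_N) : R :=
  zl * (i.+1 == 1 :> nat)%:R + zr * (i.+1 == N :> nat)%:R.

Lemma projnE n i j : projn R N n i j = ((i.+1 == n) && (j.+1 == n))%:R.
Proof. exact: mxE. Qed.

Lemma projn_neq n (i j : 'I_N) : i != j -> (i.+1 == n) && (j.+1 == n) = false.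
Proof.
by move=> ij; apply/andP => -[/eqP <- /eqP[/val_inj ji]]; rewrite ji eqxx in ij.
Qed.

(** Each [p_n a p_n] retains only the [n]-th diagonal entry of [a], so the sum is the projection
    onto diagonal matrices. *)
Lemma dephasing_entry (a : 'M[C]_N) i j :
  (\sum_(1 <= n < N.+1) projn R N n *m a *m projn R N n) i j =
  (i == j)%:R * a i j.
Proof.
rewrite summxE.
have E n : (projn R N n *m a *m projn R N n) i j =
    ((i.+1 == n) && (j.+1 == n))%:R * a i j.
  rewrite mxE (bigD1 j)//= big1 ?addr0 => [|k kj]; last first.
    by rewrite projnE projn_neq// mulr0.
  rewrite mxE (bigD1 i)//= big1 ?addr0 => [|k ki]; last first.
    by rewrite projnE projn_neq ?mul0r// eq_sym.
  by rewrite !projnE !andbb mulrAC -natrM mulnb.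
under eq_bigr do rewrite E.
rewrite -mulr_suml; congr (_ * _).
case: (eqVneq i j) => [<-|ij]; last first.
  by rewrite big1// => n _; rewrite projn_neq.
(* Sites are counted from 1 and indices from 0: the only contributing term is [n = i.+1]. *)
rewrite (bigD1_seq i.+1) ?iota_uniq ?mem_index_iota ?ltnS ?ltn_ord//=.
rewrite eqxx big1 ?addr0// => n.
by rewrite andbb eq_sym => /negbTE ->.
Qed.

Lemma loss_matrixE : zl%:C *: projn R N 1 + zr%:C *: projn R N N =
  diag_mx (\row_i (loss i)%:C).
Proof.
apply/matrixP => i j; rewrite !mxE /loss.
case: (eqVneq i j) => [<-|ij]; rewrite ?andbb ?mulr1n.
  by rewrite rmorphD !rmorphM /= !rmorph_nat.
by rewrite !projn_neq// !mulr0 addr0 mulr0n.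
Qed.

(** On the diagonal the dephasing sum cancels against [- a], so [beta] damps exactly the
    off-diagonal entries. *)
Lemma lmap_entry (a : 'M[C]_N) i j :
  l a i j = - ('i * ((hmat N v *m a) i j - (a *m hmat N v) i j))
    - ((loss i + loss j + beta * (i != j)%:R)%:C * a i j).
Proof.
rewrite /lmap loss_matrixE; set X := \sum_(_ <= _ < _) _.
have XE : X i j = (i == j)%:R * a i j := dephasing_entry a i j.
move: X XE => X XE; rewrite /commr /anticommr.
have DE : (diag_mx (\row_i (loss i)%:C) *m a) i j = (loss i)%:C * a i j.
  by rewrite mul_diag_mx !mxE.
have ED : (a *m diag_mx (\row_i (loss i)%:C)) i j = a i j * (loss j)%:C.
  by rewrite mul_mx_diag !mxE.
move: (diag_mx _ *m a) (a *m diag_mx _) DE ED => Y1 Y2 DE ED.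
move: (hmat N v *m a) (a *m hmat N v) => Z1 Z2.
rewrite !mxE DE ED XE !rmorphD rmorphM rmorph_nat /=.
by case: (eqVneq i j) => _ /=; ring.
Qed.

(** The squared modulus, valued in [R] rather than [R[i]] so that the energy identity is an identity
    of reals. *)
Definition sqnormc (z : C) : R := complex.Re z ^+ 2 + complex.Im z ^+ 2.

Lemma conjc_mulE (z : C) : conjc z * z = (sqnormc z)%:C.
Proof.
by case: z => x y; apply/eqP; rewrite eq_complex /sqnormc /=; apply/andP; split;
  apply/eqP; ring.
Qed.

Lemma sqnormc_ge0 (z : C) : 0 <= sqnormc z.
Proof. by rewrite addr_ge0 ?sqr_ge0. Qed.

Lemma sqnormc_eq0 (z : C) : sqnormc z = 0 -> z = 0.
Proof.
case: z => x y /eqP; rewrite /sqnormc paddr_eq0 ?sqr_ge0//= !sqrf_eq0.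
by move=> /andP[/eqP -> /eqP ->].
Qed.

(** The sum is [tr (a^* h a)]. Conjugation followed by exchanging the two row indices returns it
    unchanged. *)
Lemma hermitian_form_real m n (h : 'M[C]_m) (a : 'M[C]_(m, n)) :
  (forall i k, conjc (h i k) = h k i) ->
  complex.Im (\sum_i \sum_j conjc (a i j) * (h *m a) i j) = 0.
Proof.
move=> hh; set S := \sum_i _.
suff : conjc S = S.
  case: S => x y [] /eqP.
  by rewrite eq_sym -addr_eq0 -mulr2n mulrn_eq0 => /eqP.
have -> : S = \sum_j \sum_i \sum_k conjc (a i j) * (h i k * a k j).
  rewrite /S exchange_big; apply: eq_bigr => j _; apply: eq_bigr => i _.
  by rewrite mxE mulr_sumr.
rewrite rmorph_sum; apply: eq_bigr => j _.
rewrite [RHS]exchange_big rmorph_sum; apply: eq_bigr => i _.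
rewrite rmorph_sum; apply: eq_bigr => k _.
by rewrite !rmorphM /= conjcK hh mulrCA mulrA mulrC mulrA.
Qed.

Lemma hmat_hermitian i k : conjc (hmat N v i k) = hmat N v k i.
Proof.
rewrite !mxE !rmorphB rmorphM !rmorph_nat [X in X * _]conjc_real.
by case: (eqVneq (i : nat) k) => [->|_]; rewrite addrAC// !mulr0.
Qed.

Lemma hmat_sym : (hmat N v)^T = hmat N v.
Proof.
apply/matrixP => i k; rewrite !mxE.
by rewrite addrAC eq_sym; case: eqP => [->|_]//; rewrite !mulr0.
Qed.

(** Both halves [P] and [Q] of the commutator pairing are real, so [- 'i * (P - Q)] has no real
    part. *)
Lemma lmap_energy (a : 'M[C]_N) :
  complex.Re (\sum_i \sum_j conjc (a i j) * l a i j) =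
  - \sum_i \sum_j (loss i + loss j + beta * (i != j)%:R) * sqnormc (a i j).
Proof.
set P := \sum_i \sum_j conjc (a i j) * (hmat N v *m a) i j.
set Q := \sum_i \sum_j conjc (a i j) * (a *m hmat N v) i j.
have P0 : complex.Im P = 0 by apply: hermitian_form_real; exact: hmat_hermitian.
(* As [h] is symmetric, the transpose of [a h] is [h a^T], so [Q] is the Hermitian form evaluated at
   [a^T]. *)
have Q0 : complex.Im Q = 0.
  rewrite -(hermitian_form_real a^T hmat_hermitian) exchange_big /=.
  congr complex.Im; apply: eq_bigr => i _; apply: eq_bigr => j _.
  by rewrite -{2}hmat_sym -trmx_mul !mxE.
have -> : \sum_i \sum_j conjc (a i j) * l a i j = - ('i * (P - Q)) -
    (\sum_i \sum_j (loss i + loss j + beta * (i != j)%:R) * sqnormc (a i j))%:C.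
  rewrite rmorph_sum /P /Q -!sumrB mulr_sumr -!sumrN -big_split.
  apply: eq_bigr => i _ /=; rewrite rmorph_sum -!sumrB mulr_sumr -!sumrN -big_split.
  apply: eq_bigr => j _ /=; rewrite lmap_entry rmorphM /= -conjc_mulE; ring.
by case: P Q P0 Q0 => [p1 p2] [q1 q2] /= -> ->; ring.
Qed.

Lemma lmap_eigenvalue_Re_lt0 lam (a : 'M[C]_N) :
  (2 <= N)%N -> 0 <= zl -> 0 <= zr -> 0 < beta -> 0 < zl + zr ->
  a != 0 -> l a = lam *: a -> complex.Re lam < 0.
Proof.
move=> N2 zl0 zr0 beta0 zlr0 a0 la; rewrite ltNge; apply/negP => lam0.
have loss0 i : 0 <= loss i by rewrite addr_ge0 ?mulr_ge0.
have w0 i j : 0 <= (loss i + loss j + beta * (i != j)%:R) * sqnormc (a i j).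
  by rewrite mulr_ge0 ?sqnormc_ge0// !addr_ge0// mulr_ge0// ltW.
have q0 : 0 <= \sum_i \sum_j sqnormc (a i j).
  by do 2!(apply: sumr_ge0 => ? _); exact: sqnormc_ge0.
(* The energy identity equates minus this sum with the real part of [lam] times the squared norm of
   [a], which is nonnegative by assumption, while every summand is nonnegative. *)
have wE : \sum_i \sum_j
    (loss i + loss j + beta * (i != j)%:R) * sqnormc (a i j) = 0.
  have := lmap_energy a; rewrite la.
  have -> : \sum_i \sum_j conjc (a i j) * (lam *: a) i j =
      (\sum_i \sum_j sqnormc (a i j))%:C * lam.
    rewrite rmorph_sum mulr_suml; apply: eq_bigr => i _.
    rewrite rmorph_sum mulr_suml; apply: eq_bigr => j _.
    by rewrite mxE mulrCA conjc_mulE mulrC.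
  rewrite Re_real_mul => E; apply: le_anti; apply/andP; split.
    by rewrite -oppr_ge0 -E mulr_ge0.
  by do 2!(apply: sumr_ge0 => ? _).
have wij0 i j : (loss i + loss j + beta * (i != j)%:R) * sqnormc (a i j) = 0.
  have := psumr_eq0P (fun i _ => sumr_ge0 _ (fun j _ => w0 i j)) wE.
  by move=> /(_ i isT) /psumr_eq0P; exact.
have aoff i j : i != j -> a i j = 0.
  move=> ij; have /eqP := wij0 i j; rewrite ij mulf_eq0 mulr1.
  case/orP => [|/eqP/sqnormc_eq0//].
  by rewrite gt_eqF// ltr_wpDl// addr_ge0.
have adiag i : 0 < loss i -> a i i = 0.
  move=> li; have /eqP := wij0 i i; rewrite eqxx mulr0 addr0 mulf_eq0.
  by rewrite (gt_eqF (addr_gt0 li li)) => /eqP/sqnormc_eq0.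
(* At a neighbouring pair [a i j] vanishes, and with it the damping and the right-hand side. As [a]
   is diagonal, the commutator entry reduces to [h i j * (a j j - a i i)] with [h i j = - 1]. *)
have aD (i j : 'I_N) : (j = i.+1 :> nat) -> a i i = a j j.
  move=> ij; have nij : i != j.
    by apply/eqP => /(congr1 val)/eqP; rewrite /= ij ltn_eqF.
  have hij : hmat N v i j = - 1.
    by rewrite mxE ij eqxx !ltn_eqF// ?mulr0 ?sub0r ?subr0// ltnS ltnW.
  have := congr1 (fun M : 'M[C]_N => M i j) la.
  rewrite lmap_entry [RHS]mxE (aoff _ _ nij) !mulr0 subr0 => /eqP.
  have -> : (hmat N v *m a) i j = - a j j.
    rewrite mxE (bigD1 j)//= big1 ?addr0 => [|k kj]; first by rewrite hij mulN1r.
    by rewrite aoff// mulr0.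
  have -> : (a *m hmat N v) i j = - a i i.
    rewrite mxE (bigD1 i)//= big1 ?addr0 => [|k ki]; first by rewrite hij mulrN1.
    by rewrite aoff ?mul0r// eq_sym.
  rewrite oppr_eq0 mulf_eq0 => /orP[|].
    by rewrite eq_complex /= oner_eq0 andbF.
  by rewrite opprK addrC subr_eq0 => /eqP.
have N0 : (0 < N)%N by exact: leq_trans N2.
have NE : (N.-1 < N)%N by rewrite prednK.
pose i0 := Ordinal N0; pose i1 := Ordinal NE.
have aconst k (kN : (k < N)%N) : a (Ordinal kN) (Ordinal kN) = a i0 i0.
  elim: k kN => [|k IH] kN; first by congr (a _ _); exact: val_inj.
  by rewrite -(IH (ltnW kN)); apply/esym/aD.
(* At least one of [zl], [zr] is positive and kills the diagonal entry at its end; if it is the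
   right one, constancy of the diagonal carries the zero to the left end. *)
have aend : a i0 i0 = 0.
  have [zl_gt0|zl_le0] := ltP 0 zl.
    by apply: adiag; rewrite /loss /= mulr1 ltr_wpDr// mulr_ge0.
  have zr_gt0 : 0 < zr by rewrite (lt_le_trans zlr0)// gerDr.
  rewrite -(aconst _ NE); apply: adiag.
  by rewrite /loss /= prednK// eqxx mulr1 ltr_wpDl// mulr_ge0.
move/eqP: a0; apply; apply/matrixP => i j; rewrite mxE.
have [<-|/aoff//] := eqVneq i j.
by case: i => k kN; rewrite aconst.
Qed.

End Spectrum.

Theorem theorem2p1 (R : realType) (N : nat) (v : nat -> R)
  (ainl aoutl ainr aoutr beta : R) :
  (2 <= N)%N ->
  (exists M : R, forall n : nat, `|v n| <= M) ->
  0 <= ainl -> 0 <= aoutl -> 0 <= ainr -> 0 <= aoutr -> 0 <= beta ->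
  0 < beta -> 0 < (ainl + aoutl) + (ainr + aoutr) ->
  let l := @lmap R N v (ainl + aoutl) (ainr + aoutr) beta in
  (forall lam : R[i], (exists a : 'M[R[i]]_N, a != 0 /\ l a = lam *: a) ->
     complex.Re lam < 0)
  /\ bijective l
  /\ (forall a : 'M[R[i]]_N, expmap l t a @[t --> +oo] --> (0 : 'M[R[i]]_N)).
Proof.
move=> N2 _ ainl0 aoutl0 ainr0 aoutr0 _ beta0 zeta0 l.
have l_eig lam a : a != 0 -> l a = lam *: a -> complex.Re lam < 0.
  by apply: lmap_eigenvalue_Re_lt0; rewrite ?addr_ge0.
split; first by move=> lam [a []]; exact: l_eig.
split; last exact: (expmap_decay (L := l)).
(* A nonzero kernel element would be an eigenvector for 0, whose real part is not negative. *)
apply: (@linear_mx_bijective _ _ _ l) => a la0.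
apply/eqP; apply: contraT => a0.
have := l_eig 0 a a0 (etrans la0 (esym (scale0r a))).
by rewrite ltxx.
Qed.
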